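(* There exists an absolute constant $c>0$ such that for every prime power $q$ and all sets $A\subset SL_2(\mathbb{F}_q)$ and $B\subset M_2(\mathbb{F}_q)$, \[|A+B|\ \ge\ c\,\min\left\{ \frac{|A|^2|B|}{q^3},\ |A|\,q\right\},\] where $A+B=\{a+b: a\in A,\ b\in B\}$.
   Context: $\mathbb{F}_q$ is the finite field with $q$ elements, $M_2(\mathbb{F}_q)$ is the ring of $2\times 2$ matrices over $\mathbb{F}_q$, and $SL_2(\mathbb{F}_q)$ is the set of matrices in $M_2(\mathbb{F}_q)$ with determinant $1$. *)

(* Defs.v *)
From HB Require Import structures.
From mathcomp Require Import all_boot all_order all_algebra.
From mathcomp Require Import reals.

Set Implicit Arguments.
Unset Strict Implicit.
Unset Printing Implicit Defensive.

Import Order.TTheory GRing.Theory Num.Theory.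

Local Open Scope ring_scope.

Definition SL2 (F : finFieldType) : {set 'M[F]_2} :=
  [set M : 'M[F]_2 | \det M == 1].

Definition sumset (F : finFieldType) (A B : {set 'M[F]_2}) : {set 'M[F]_2} :=
  [set a + b | a in A, b in B].

(* Main.v *)
(** Write [q] for the order of the field and [C = A + B].  Each of the |A||B|
    pairs (b, a + b) is an edge of the Cayley graph of (M_2, +) generated by
    SL_2, so it suffices to count the edges between B and C.  Completing the
    square in the determinant shows that the nontrivial eigenvalues of this
    graph are [q] times Kloosterman sums, hence at most [2 q^(3/2)] in absolute
    value, and the expander mixing lemma gives
    [|A||B| <= |B||C|/q + 2 q^(3/2) (|B||C|)^(1/2)].

    The bound [K^2 <= 4q] for a Kloosterman sum is proved over all finite fields
    at once.  If [K'] is the sum lifted to the quadratic extension then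
    [K^2 + K' = 2q], so [t = K^2/q] is transformed into [(t - 2)^2]: an excess
    [t - 4 > 0] grows at least fourfold at each of infinitely many quadratic
    extensions.  This contradicts the weak bound [|K| <= 2p q^(1/2) + 1] in
    characteristic [p], which comes from Stepanov's method: with
    [q = q0^2], the points where [Tr(ax + b/x) = c] satisfy [u + u^q0 = c] for a
    Laurent polynomial [u] of degree [q0/p], and there is a nonzero combination
    of the [x^(j + k q0) u^i] of degree about [q/p] vanishing at all of them. *)
Require Import Defs.
From HB Require Import structures.
From mathcomp Require Import all_boot all_order all_algebra.
From mathcomp Require Import reals.
From mathcomp Require Import all_field zify ring.

Set Implicit Arguments.
Unset Strict Implicit.
Unset Printing Implicit Defensive.

Import Order.TTheory GRing.Theory Num.Theory.

Local Open Scope ring_scope.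

(** * Frobenius powers and the absolute trace *)

Section FrobeniusPower.

Variables (F : finFieldType) (p : nat).
Hypothesis pcharFp : p \in [pchar F].

Let pcharF_nat i : [pchar F].-nat (p ^ i)%N.
Proof. by rewrite pnatX (pnatE _ (pcharf_prime pcharFp)) pcharFp. Qed.

Lemma exprDn_pchar_pow i (x y : F) :
  (x + y) ^+ (p ^ i) = x ^+ (p ^ i) + y ^+ (p ^ i).
Proof. exact: exprDn_pchar (pcharF_nat i). Qed.

Lemma exprn_pchar_pow_sum (I : Type) (r : seq I) (P : pred I) (E : I -> F) i :
  (\sum_(j <- r | P j) E j) ^+ (p ^ i) = \sum_(j <- r | P j) E j ^+ (p ^ i).
Proof.
have z : 0 ^+ (p ^ i) = 0 :> F.
  by rewrite expr0n expn_eq0 -leqn0 leqNgt prime_gt0 ?(pcharf_prime pcharFp).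
exact: (big_morph (fun x => x ^+ (p ^ i)) (exprDn_pchar_pow i) z).
Qed.

(** For [#|F| = p ^ n] this is the absolute trace. The length [n] stays free because Stepanov's
    argument also needs the half-length sum, with [m] terms in a field of order [p ^ (2 * m)]. *)
Definition ftrace n (x : F) : F := \sum_(i < n) x ^+ (p ^ i).

Lemma ftraceD n x y : ftrace n (x + y) = ftrace n x + ftrace n y.
Proof.
by rewrite -big_split; apply: eq_bigr => i _; rewrite exprDn_pchar_pow.
Qed.

Lemma ftrace_exp n x : #|F| = (p ^ n)%N -> ftrace n x ^+ p = ftrace n x.
Proof.
move=> cF; rewrite -{1}[p]expn1 exprn_pchar_pow_sum.
case: n cF => [|n] cF; first by rewrite /ftrace !big_ord0.
rewrite /ftrace big_ord_recr big_ord_recl /= expn0 expr1 addrC; congr (_ + _).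
  by rewrite -exprM -expnD addn1 -cF expf_card.
by apply: eq_bigr => i _; rewrite -exprM -expnD addn1.
Qed.

Lemma natr_pchar_eq i j : (i%:R == j%:R :> F) = (i == j %[mod p]).
Proof.
wlog le_ij: i j / (j <= i)%N => [W|].
  by case/orP: (leq_total j i) => /W // e; rewrite eq_sym e eq_sym.
by rewrite -subr_eq0 -natrB // -(dvdn_pcharf pcharFp) eqn_mod_dvd.
Qed.

(** The [p] elements of the prime field already exhaust the roots of [X^p - X]. *)
Lemma exprp_fixed (y : F) : y ^+ p = y -> exists2 k, (k < p)%N & y = k%:R.
Proof.
move=> yp; have pp := pcharf_prime pcharFp; have p1 := prime_gt1 pp.
have P0 : 'X^p - 'X != 0 :> {poly F}.
  rewrite -size_poly_eq0 size_polyDl ?size_polyXn // size_polyN size_polyX.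
  by rewrite ltnS.
pose s : seq F := [seq k%:R | k <- iota 0 p].
have us : uniq s.
  rewrite map_inj_in_uniq ?iota_uniq // => i j; rewrite !mem_iota !add0n /=.
  by move=> ip jp /eqP; rewrite natr_pchar_eq !modn_small // => /eqP.
have [ys|yNs] := boolP (y \in s).
  by case/mapP: ys => k; rewrite mem_iota => /andP[_ kp] ->; exists k.
have := @max_poly_roots _ _ (y :: s) P0.
rewrite /= yNs us size_map size_iota size_polyDl; last first.
  by rewrite size_polyN size_polyX size_polyXn ltnS.
rewrite size_polyXn ltnn => absurd; case: notF; apply: absurd => //.
rewrite rootE !hornerE yp subrr eqxx /=.
apply/allP => _ /mapP[k _ ->]; rewrite rootE !hornerE.
by rewrite -(pFrobenius_autE pcharFp) pFrobenius_aut_nat subrr.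
Qed.

(** The trace is a polynomial function of degree [p ^ (n - 1)], too small for all of [F] to be
    roots. *)
Lemma ftrace_neq0 n : #|F| = (p ^ n)%N -> exists x, ftrace n x != 0.
Proof.
move=> cF; have p1 := prime_gt1 (pcharf_prime pcharFp).
case: n cF => [|n] cF; first by have := finNzRing_gt1 F; rewrite cF expn0.
pose P : {poly F} := \sum_(i < n.+1) 'X^(p ^ i).
have sP : size P = (p ^ n).+1.
  rewrite /P big_ord_recr /= addrC size_polyDl ?size_polyXn //.
  rewrite ltnS (leq_trans (size_sum _ _ _)) //; apply/bigmax_leqP => i _.
  by rewrite size_polyXn ltn_exp2l.
have P0 : P != 0 by rewrite -size_poly_eq0 sP.
apply/existsP; apply: contraT; rewrite negb_exists => /forallP H.
have := @max_poly_roots _ _ (enum F) P0.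
rewrite enum_uniq sP -cardE cF ltnS leq_exp2l // ltnn => -> //.
apply/allP => x _; rewrite rootE horner_sum.
move: (H x); rewrite negbK /ftrace => /eqP h; apply/eqP.
by rewrite -[RHS]h; apply: eq_bigr => i _; rewrite hornerXn.
Qed.

End FrobeniusPower.

(** * Stepanov's method *)

Section PolynomialFamilies.

Variables (F : fieldType) (I : finType).

Lemma exists_poly_relation (P : I -> {poly F}) d :
    (forall i, (size (P i) <= d)%N) -> (d < #|I|)%N ->
  exists2 b : I -> F, exists i, b i != 0 & \sum_i b i *: P i = 0.
Proof.
move=> sP dI; pose M := \matrix_(k < #|I|) poly_rV (P (enum_val k)) : 'M[F]_(_, d).
have : kermx M != 0.
  by rewrite kermx_eq0 /row_free neq_ltn (leq_ltn_trans (rank_leq_col M)).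
case/rowV0Pn => v /sub_kermxP vM v0; exists (fun i => v 0 (enum_rank i)).
  have [k vk] : exists k, v 0 k != 0.
    apply/existsP; apply: contraNT v0; rewrite negb_exists => /forallP h.
    by apply/eqP/rowP => k; rewrite mxE; have:= h k; rewrite negbK => /eqP.
  by exists (enum_val k); rewrite enum_valK.
move/(congr1 rVpoly): vM; rewrite linear0; apply: etrans.
rewrite mulmx_sum_row linear_sum /= (reindex_onto enum_val enum_rank) /=.
  apply: eq_big => [k|k _]; first by rewrite enum_valK eqxx.
  by rewrite linearZ /= rowK poly_rV_K // enum_valK.
by move=> i _; rewrite enum_rankK.
Qed.

(** Among the terms with a nonzero coefficient, the one of largest degree has a leading term that
    nothing cancels. *)
Lemma distinct_size_sum_neq0 (P : I -> {poly F}) (a : I -> F) :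
    (forall i, P i != 0) -> injective (fun i => size (P i)) ->
  (exists i, a i != 0) -> \sum_i a i *: P i != 0.
Proof.
move=> P0 injP [i0 ai0].
case: (@arg_maxnP I i0 (fun i => a i != 0) (fun i => size (P i))) => //.
move=> j aj maxj; rewrite (bigD1 j) //= -size_poly_eq0 size_polyDl.
  by rewrite size_scale // size_poly_eq0.
rewrite size_scale // -(prednK (_ : 0 < size (P j))%N) ?size_poly_gt0 // ltnS.
rewrite (leq_trans (size_sum _ _ _)) //; apply/bigmax_leqP => i ij.
have [->|ai] := eqVneq (a i) 0; first by rewrite scale0r size_poly0.
rewrite size_scale // -ltnS prednK ?size_poly_gt0 // ltn_neqAle.
have -> : (size (P i) <= size (P j))%N := maxj i ai.
rewrite andbT; apply: contraNneq ij => e; exact/eqP/injP.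
Qed.

End PolynomialFamilies.

Section Stepanov.

Variables (F : finFieldType) (p m : nat) (a b c : F).
Hypothesis pcharFp : p \in [pchar F].
Hypotheses (cardF : #|F| = (p ^ (2 * m))%N) (m_gt1 : (1 < m)%N) (a0 : a != 0).

Let r := (p ^ m.-1)%N.
Let q0 := (p ^ m)%N.
Let p_gt1 : (1 < p)%N. Proof. exact: prime_gt1 (pcharf_prime pcharFp). Qed.
Let q0E : q0 = (r * p)%N.
Proof. by rewrite /q0 /r -expnSr prednK // ltnW. Qed.
Let r_gt1 : (1 < r)%N.
Proof. by rewrite /r -(expn0 p) ltn_exp2l //; lia. Qed.

Let f x := a * x + b / x.
Let u x := ftrace p m (f x).

Let leq_pi (i : 'I_m) : (p ^ i <= r)%N.
Proof. by rewrite leq_exp2l //; case: i => i /= ; lia. Qed.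

Let w : {poly F} :=
  \sum_(i < m) (a ^+ (p ^ i) *: 'X^(r + p ^ i) + b ^+ (p ^ i) *: 'X^(r - p ^ i)).

Let hornerw (x : F) : x != 0 -> w.[x] = x ^+ r * u x.
Proof.
move=> x0; rewrite horner_sum /u /ftrace mulr_sumr; apply: eq_bigr => i _.
rewrite !hornerE ?hornerXn exprDn_pchar_pow // mulrDr !exprMn exprVn exprD.
by rewrite expfB_cond ?(negPf x0) ?leq_pi //; field; rewrite expf_neq0.
Qed.

(** The top term is [a^r X^(2r)], from [i = m - 1]; it survives because [a] is nonzero. *)
Let size_w : size w = (2 * r).+1.
Proof.
rewrite /w; case: m m_gt1 leq_pi @r => // n n1 leq_p r'.
have rE : r' = (p ^ n)%N by [].
rewrite big_ord_recr /= addrCA -[(p ^ n)%N]/r' size_polyDl.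
  by rewrite size_scale ?expf_neq0 // size_polyXn; lia.
rewrite size_scale ?expf_neq0 // size_polyXn ltnS.
rewrite (leq_trans (size_polyD _ _)) // geq_max; apply/andP; split.
  rewrite (leq_trans (size_sum _ _ _)) //; apply/bigmax_leqP => i _.
  have lt_i : (p ^ i < r')%N by rewrite rE ltn_exp2l.
  rewrite (leq_trans (size_polyD _ _)) // geq_max.
  rewrite !(leq_trans (size_scale_leq _ _)) // size_polyXn; lia.
by rewrite (leq_trans (size_scale_leq _ _)) // size_polyXn; lia.
Qed.

Let I := ('I_r * 'I_r.+1 * 'I_p)%type.

Let v := c *: 'X^r - w.

(* The basis functions are multiplied by [x^((p-1)r)] to clear the poles of [u];
   [w = x^r u], and [v = x^r (c - u)] takes the values of [x^r u^q0] on the fiber. *)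
Let P (t : I) : {poly F} :=
  'X^(t.1.1 + t.1.2 * q0) * w ^+ t.2 * 'X^((p.-1 - t.2) * r).
Let Q (t : I) : {poly F} :=
  'X^(t.1.1 * q0 + t.1.2) * v ^+ t.2 * 'X^((p.-1 - t.2) * r).

Let size_v : (size v <= (2 * r).+1)%N.
Proof.
rewrite (leq_trans (size_polyD _ _)) // size_polyN size_w geq_max leqnn andbT.
by rewrite (leq_trans (size_scale_leq _ _)) // size_polyXn; lia.
Qed.

Let w0 : w != 0. Proof. by rewrite -size_poly_eq0 size_w. Qed.

(* The degrees of the [P t] are distinct: [j + r (i + p k)] is a mixed radix
   expansion. *)
Let size_P t : size (P t) = (t.1.1 + r * (t.2 + p * t.1.2) + p.-1 * r).+1.
Proof.
case: t => [[j k] i] /=.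
have -> : size (P (j, k, i)) = (j + k * q0 + (2 * r) * i + (p.-1 - i) * r).+1.
  have X0 n : 'X^n != 0 :> {poly F} by rewrite -size_poly_eq0 size_polyXn.
  rewrite /P /= size_mulXn ?mulf_neq0 ?X0 ?expf_neq0 //.
  rewrite mulrC size_mulXn ?expf_neq0 //.
  have -> : size (w ^+ i) = (2 * r * i).+1.
    by rewrite -(prednK (_ : 0 < size (w ^+ i))%N) ?size_poly_gt0 ?expf_neq0 //
               size_exp size_w.
  by lia.
rewrite q0E; congr _.+1; have ip := ltn_ord i.
have -> : (p.-1 * r = (p.-1 - i) * r + i * r)%N by rewrite -mulnDl; congr muln; lia.
by lia.
Qed.

Let size_Q t : (size (Q t) <= r * q0 + q0 - r + 1)%N.
Proof.
case: t => [[j k] i]; rewrite /Q /=.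
have -> : 'X^(j * q0 + k) * v ^+ i * 'X^((p.-1 - i) * r)
    = v ^+ i * 'X^(j * q0 + k + (p.-1 - i) * r) by rewrite [in RHS]exprD; ring.
rewrite (leq_trans (size_polyMleq _ _)) // size_polyXn.
have s1 : (size (v ^+ i) <= (2 * r * i).+1)%N.
  rewrite (leq_trans (size_poly_exp_leq _ _)) // ltnS leq_mul2r.
  by rewrite -ltnS (leq_trans (leqSpred _)) ?orbT //; move: size_v; lia.
have ip := ltn_ord i; have jr := ltn_ord j; have kr := ltn_ord k.
have e1 : (j * q0 <= (r - 1) * q0)%N by rewrite leq_mul2r; apply/orP; right; lia.
have e2 : (2 * r * i + (p.-1 - i) * r <= 2 * r * p.-1)%N.
  have -> : (2 * r * p.-1 = 2 * r * i + 2 * r * (p.-1 - i))%N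
    by rewrite -mulnDr; congr muln; lia.
  by rewrite leq_add2l mulnC leq_mul2r; apply/orP; right; lia.
have e3 : (2 * r * p.-1 + 2 * r = 2 * q0)%N.
  by rewrite q0E -{2}[(2 * r)%N]muln1 -mulnDr addn1 prednK ?mulnA // ltnW.
have e4 : ((r - 1) * q0 + q0 = r * q0)%N.
  by rewrite -{2}[q0]mul1n -mulnDl subnK // ltnW.
have e5 : (r <= q0)%N by rewrite q0E leq_pmulr // ltnW.
lia.
Qed.

Let frob_sum (J : Type) (s : seq J) (E : J -> F) :
  (\sum_(j <- s) E j) ^+ q0 = \sum_(j <- s) E j ^+ q0.
Proof. exact: exprn_pchar_pow_sum. Qed.

Let ftrace_split (x : F) : ftrace p (2 * m) x = ftrace p m x + ftrace p m x ^+ q0.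
Proof.
rewrite {1}/ftrace mul2n -addnn big_split_ord /=; congr (_ + _).
rewrite exprn_pchar_pow_sum //; apply: eq_bigr => i _.
by rewrite -exprM -expnD addnC.
Qed.

(** The leading term [p ^ (2 * m).-1] is the average [#|F| / p]; the error is twice the square root
    of [#|F|]. *)
Lemma card_ftrace_fiber :
  (#|[set x : F | (x != 0%R) && (ftrace p (2 * m) (a * x + b / x)%R == c)]|
     <= p ^ (2 * m).-1 + 2 * p ^ m)%N.
Proof.
have -> : (p ^ (2 * m).-1 = r * q0)%N by rewrite -expnD; congr expn; lia.
have e5 : (r <= q0)%N by rewrite q0E leq_pmulr // ltnW.
(* There are [r (r + 1) p = r q0 + q0] polynomials [Q t], in a space of dimension
   [r q0 + q0 - r + 1]. The former is larger since [r > 1]. *)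
have [|be [t0 bet0] beQ] := @exists_poly_relation F I Q _ size_Q.
  rewrite !card_prod !card_ord.
  have -> : (r * r.+1 * p = r * q0 + q0)%N by rewrite q0E; lia.
  by move: r_gt1; lia.
(* On the fiber, [x^(q0^2) = x] and [u^q0 = c - u], so the [q0]-th power of
   [sum al (P t)] is [sum be (Q t)] up to a power of [x], that is [0]. *)
pose al t := be t ^+ q0.
have alK t : al t ^+ q0 = be t.
  by rewrite -exprM -expnD addnn -mul2n -cardF expf_card.
pose G := \sum_t al t *: P t.
have G0 : G != 0.
  apply: distinct_size_sum_neq0.
  - by move=> t; rewrite -size_poly_eq0 size_P.
  - move=> [[j k] i] [[j' k'] i']; rewrite !size_P /= => e.
    have {}e : (j + r * (i + p * k) = j' + r * (i' + p * k'))%N by lia.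
    have r_gt0 := ltnW r_gt1; have p_gt0 := ltnW p_gt1.
    have ej : j = j' :> nat.
      by move/(congr1 (modn^~ r)): e; rewrite !(addnC _ (r * _)%N) !(mulnC r) !modnMDl !modn_small.
    move: e; rewrite ej => /eqP; rewrite eqn_add2l eqn_pmul2l // => /eqP e.
    have ei : i = i' :> nat.
      by move/(congr1 (modn^~ p)): e; rewrite !(addnC _ (p * _)%N) !(mulnC p) !modnMDl !modn_small.
    move: e; rewrite ei => /eqP; rewrite eqn_add2l eqn_pmul2l // => /eqP ek.
    by rewrite (val_inj ej) (val_inj ek) (val_inj ei).
  - by exists t0; rewrite expf_neq0.
have size_G : (size G <= r * q0 + 2 * q0)%N.
  rewrite (leq_trans (size_sum _ _ _)) //; apply/bigmax_leqP => [[[j k] i] _].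
  rewrite (leq_trans (size_scale_leq _ _)) // size_P /=.
  have ip := ltn_ord i; have jr := ltn_ord j; have kr := ltn_ord k.
  have h1 : (r * (i + p * k) <= r * (p.-1 + p * r))%N.
    by rewrite leq_mul2l leq_add ?orbT // ?leq_mul2l; lia.
  have h2 : (r * p.-1 + r = q0)%N by rewrite q0E addnC -mulnS prednK // ltnW.
  have h3 : (r * (p.-1 + p * r) = r * p.-1 + r * q0)%N by rewrite q0E; lia.
  lia.
rewrite cardE -ltnS (leq_trans _ (_ : size G < _)%N) ?ltnS //.
apply: ltnW; apply: (max_poly_roots G0); last exact: enum_uniq.
apply/allP => x; rewrite mem_enum inE => /andP[x0 /eqP tr].
have uq : u x ^+ q0 = c - u x by rewrite -tr ftrace_split addrC addKr.
have xq : x ^+ q0 ^+ q0 = x by rewrite -exprM -expnD addnn -mul2n -cardF expf_card.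
have GE : G.[x] = x ^+ (p.-1 * r) *
    \sum_t al t * (x ^+ (t.1.1 + t.1.2 * q0) * u x ^+ t.2).
  rewrite horner_sum mulr_sumr; apply: eq_bigr => [[[j k] i] _].
  rewrite /P /= !hornerE ?hornerXn ?horner_exp hornerw //.
  have -> : (p.-1 * r = (p.-1 - i) * r + r * i)%N.
    by rewrite [in RHS]mulnC -mulnDr mulnC; congr muln; have := ltn_ord i; lia.
  by rewrite exprMn [x ^+ (_ + r * i)]exprD -exprM /=; ring.
have QE : (\sum_t be t *: Q t).[x] = x ^+ (p.-1 * r) *
    \sum_t be t * (x ^+ (t.1.1 * q0 + t.1.2) * (c - u x) ^+ t.2).
  rewrite horner_sum mulr_sumr; apply: eq_bigr => [[[j k] i] _].
  rewrite /Q /= !hornerE ?hornerXn ?horner_exp ?hornerE ?hornerXn hornerw //.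
  have -> : (p.-1 * r = (p.-1 - i) * r + r * i)%N.
    by rewrite [in RHS]mulnC -mulnDr mulnC; congr muln; have := ltn_ord i; lia.
  have -> : c * x ^+ r - x ^+ r * u x = x ^+ r * (c - u x) by ring.
  by rewrite exprMn [x ^+ (_ + r * i)]exprD -exprM /=; ring.
rewrite rootE GE mulf_eq0 expf_eq0 (negPf x0) andbF /=.
move/eqP: QE; rewrite beQ horner0 eq_sym mulf_eq0 expf_eq0 (negPf x0) andbF /=.
set S := \sum_t _ => /eqP S0; set T := \sum_t _.
suff /eqP : T ^+ q0 = 0 by rewrite expf_eq0 => /andP[].
(* The [q0]-th power swaps the roles of [j] and [k], turning [x^(j + k q0)] into [x^(j q0 + k)], and
   sends [u x] to [c - u x]. *)
rewrite -[RHS]S0 frob_sum; apply: eq_bigr => [[[j k] i] _] /=.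
rewrite !exprMn alK -uq; congr (_ * (_ * _)); last exact: exprAC.
rewrite !exprD exprMn -exprM; congr (_ * _).
by rewrite mulnC exprM [_ ^+ k ^+ q0]exprAC xq.
Qed.


End Stepanov.

(** * The trace character *)

(** This is [zeta^Tr(x)]: the trace lies in the prime field, and [index] reads it as a natural
    number below [p]. *)
Definition addchar (F : finFieldType) (zeta : algC) p n (x : F) : algC :=
  zeta ^+ index (ftrace p n x) [seq k%:R | k <- iota 0 p].

Definition kloosterman (F : finFieldType) (psi : F -> algC) (a b : F) : algC :=
  \sum_(x | x != 0) psi (a * x + b / x).

Definition additive_char (F : finFieldType) (psi : F -> algC) :=
  [/\ psi 0 = 1, {morph psi : x y / x + y >-> x * y} & exists x, psi x != 1].

Section TraceCharacter.

Variables (F : finFieldType) (p n : nat) (zeta : algC).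
Hypotheses (pcharFp : p \in [pchar F]) (cardF : #|F| = (p ^ n)%N).
Hypothesis zeta_prim : p.-primitive_root zeta.

Local Notation psi := (@addchar F zeta p n).

Lemma ftrace_nat (x : F) : exists2 k, (k < p)%N & ftrace p n x = k%:R.
Proof. by apply: exprp_fixed => //; apply: ftrace_exp. Qed.

(** Here [k] may exceed [p], so that exponents can be added without reduction. *)
Lemma addchar_nat (x : F) k : ftrace p n x = k%:R -> psi x = zeta ^+ k.
Proof.
move=> trx; apply/eqP; rewrite (eq_prim_root_expr zeta_prim).
rewrite -(natr_pchar_eq pcharFp) -trx.
set s := [seq _ | _ <- _]; have [l lp trl] := ftrace_nat x.
have xs : ftrace p n x \in s by apply/mapP; exists l; rewrite ?mem_iota.
have := nth_index 0 xs; rewrite (nth_map 0%N).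
  by rewrite nth_iota ?add0n => [->|] //; move: xs; rewrite -index_mem size_map size_iota.
by move: xs; rewrite -index_mem size_map.
Qed.

Lemma addchar_additive : additive_char psi.
Proof.
split.
- rewrite (@addchar_nat 0 0) ?expr0 // /ftrace big1 // => i _.
  by rewrite expr0n expn_eq0 -leqn0 leqNgt prime_gt0 ?(pcharf_prime pcharFp).
- move=> x y; have [[k _ kx] [l _ ly]] := (ftrace_nat x, ftrace_nat y).
  rewrite (addchar_nat kx) (addchar_nat ly) -exprD; apply: addchar_nat.
  by rewrite ftraceD // kx ly natrD.
have [x trx] := ftrace_neq0 pcharFp cardF; exists x.
have [k kp kx] := ftrace_nat x; rewrite (addchar_nat kx).
rewrite -(expr0 zeta) (eq_prim_root_expr zeta_prim) -(natr_pchar_eq pcharFp).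
by rewrite -kx.
Qed.

End TraceCharacter.

(* Only the upper bound on the fibers of the trace is needed: their sizes sum to
   [#|F| - 1] and [sum zeta^k = 0]. *)
Lemma kloosterman_weak (F : finFieldType) p m zeta (a b : F) :
    p \in [pchar F] -> #|F| = (p ^ (2 * m))%N -> (1 < m)%N ->
    p.-primitive_root zeta -> a != 0 ->
  `|kloosterman (addchar zeta p (2 * m)) a b| <= (2 * p ^ m.+1).+1%:R.
Proof.
move=> pcharFp cardF m1 zp a0; have pp := pcharf_prime pcharFp.
pose f x := a * x + b / x; set psi := addchar _ _ _.
pose N (k : 'I_p) := #|[set x | (x != 0) && (ftrace p (2 * m) (f x) == k%:R)]|.
pose M := (p ^ (2 * m).-1 + 2 * p ^ m)%N.
have NM k : (N k <= M)%N by apply: card_ftrace_fiber.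
have part (G : F -> algC) : \sum_(x | x != 0) G x = \sum_(k < p)
    \sum_(x | (x != 0) && (ftrace p (2 * m) (f x) == k%:R)) G x.
  rewrite (exchange_big_dep (fun x => x != 0)) /=; last by move=> ? ? _ /andP[].
  apply: eq_bigr => x x0.
  have [k kp kx] := ftrace_nat pcharFp cardF (f x).
  rewrite (big_pred1 (Ordinal kp)) // => l; rewrite x0 kx /=.
  rewrite (natr_pchar_eq pcharFp) !modn_small // eq_sym.
  by apply/eqP/eqP => [e|-> //]; apply: val_inj.
have KE : kloosterman psi a b = \sum_(k < p) zeta ^+ k * (N k)%:R.
  rewrite /kloosterman part; apply: eq_bigr => k _.
  rewrite (eq_bigr (fun=> zeta ^+ k)).
    by rewrite sumr_const mulr_natr /N cardsE.
  by move=> x /andP[_ /eqP/(addchar_nat pcharFp cardF zp)].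
have zs : \sum_(k < p) zeta ^+ k = 0.
  have := prim_expr_order zp; move/eqP; rewrite -subr_eq0 subrX1 mulf_eq0.
  case/orP => [|/eqP //]; rewrite subr_eq0 => /eqP z1.
  have := eq_prim_root_expr zp 1 0; rewrite z1 !expr1n eqxx.
  by rewrite mod0n modn_small ?prime_gt1.
have sN : (\sum_(k < p) N k = (p ^ (2 * m)).-1)%N.
  apply/eqP; rewrite -(eqr_nat algC) natr_sum.
  have e := part (fun=> 1); rewrite sumr_const in e.
  have <- : #|[pred x : F | x != 0]| = (p ^ (2 * m)).-1%N.
    by rewrite -cardF (cardD1 0 F) inE; apply: eq_card => x; rewrite !inE andbT.
  rewrite [X in _ == X]e; apply/eqP/eq_bigr => k _.
  by rewrite sumr_const /N cardsE.
(* As the [zeta ^+ k] sum to zero, each [N k] may be shifted by [M]. All [M - N k] are nonnegative,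
   so the triangle inequality costs only [p M - (#|F| - 1) = 2 p^(m+1) + 1]. *)
have -> : kloosterman psi a b = \sum_(k < p) zeta ^+ k * ((N k)%:R - M%:R).
  rewrite KE; under [in RHS]eq_bigr do rewrite mulrBr.
  by rewrite sumrB -mulr_suml zs mul0r subr0.
apply: le_trans (ler_norm_sum _ _ _) _.
have nz k : `|zeta ^+ k| = 1.
  apply/eqP; rewrite -(@pexpr_eq1 _ _ p) ?prime_gt0 //.
  by rewrite -normrX exprAC (prim_expr_order zp) expr1n normr1.
under eq_bigr => k _ do
  rewrite normrM nz mul1r distrC -natrB // normr_nat.
rewrite -natr_sum ler_nat sumnB // sN sum_nat_const card_ord /M.
have e1 : (p * p ^ (2 * m).-1 = p ^ (2 * m))%N by rewrite -expnS prednK //; lia.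
have e2 : (p * (2 * p ^ m) = 2 * p ^ m.+1)%N by rewrite expnS mulnCA.
have : (0 < p ^ (2 * m))%N by rewrite expn_gt0 prime_gt0.
by rewrite mulnDr e1 e2; lia.
Qed.

(** * Lifting Kloosterman sums to quadratic extensions *)

Section AdditiveCharacters.

Variables (F : finFieldType) (psi : F -> algC).
Hypothesis psiP : additive_char psi.

Let psi0 : psi 0 = 1. Proof. by case: psiP. Qed.
Let psiD x y : psi (x + y) = psi x * psi y. Proof. by case: psiP. Qed.

(** Values of [psi] are [p]-th roots of unity, so inversion is conjugation. *)
Lemma additive_charN x : psi (- x) = (psi x)^*.
Proof.
have [p pp pcharFp] := finPcharP F.
have psi_nat k : psi (x *+ k) = psi x ^+ k.
  by elim: k => [|k IH]; rewrite ?mulr0n ?psi0 // mulrS psiD IH exprS.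
have n1 : `|psi x| = 1.
  apply/eqP; rewrite -(@pexpr_eq1 _ _ p) ?prime_gt0 // -normrX -psi_nat.
  by rewrite -mulr_natr (pcharf0 pcharFp) mulr0 psi0 normr1.
have x0 : psi x != 0 by rewrite -normr_eq0 n1 oner_eq0.
apply: (mulIf x0); rewrite -psiD addNr psi0 mulrC -normCK n1 expr1n //.
Qed.

(** For [m != 0], translating [x] by [y / m] with [psi y != 1] multiplies the sum by [psi y]. *)
Lemma sum_additive_char m : \sum_x psi (m * x) = #|F|%:R * (m == 0)%:R.
Proof.
have [->|m0] := eqVneq m 0.
  under eq_bigr do rewrite mul0r psi0.
  by rewrite sumr_const mulr1.
rewrite mulr0; have [_ _ [y y1]] := psiP.
pose S := \sum_x psi (m * x); rewrite -/S.
have : psi y * S = S.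
  rewrite /S mulr_sumr [RHS](reindex (fun x => x + y / m)); last first.
    by exists (fun x => x - y / m) => x _; rewrite ?addrK ?subrK.
  by apply: eq_bigr => x _; rewrite -psiD; congr psi; field.
move/eqP; rewrite -subr_eq0 -{2}[S]mul1r -mulrBl mulf_eq0 subr_eq0 (negPf y1).
by move/eqP.
Qed.

Lemma kloosterman_real a b : kloosterman psi a b \is Num.real.
Proof.
apply/CrealP; rewrite rmorph_sum /= [RHS](reindex_inj oppr_inj) /=.
apply: eq_big => x; first by rewrite oppr_eq0.
by move=> _; rewrite -additive_charN; congr psi; rewrite invrN; ring.
Qed.

End AdditiveCharacters.

Lemma finField_card_pow (F : finFieldType) p :
  p \in [pchar F] -> exists n, #|F| = (p ^ n)%N.
Proof. by move=> pcharFp; eexists; apply: (card_pprimeChar pcharFp). Qed.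

Section Doubling.

Variables (F E : finFieldType) (iota : {rmorphism F -> E}).
Hypothesis card_ext : #|E| = (#|F| ^ 2)%N.
Local Notation q := #|F|.

(** The [q] elements of the image of [iota] exhaust the roots of [X^q - X]. Relative traces and
    norms thereby descend to [F]. *)
Lemma expr_card_fixed z : z ^+ q = z -> exists x, z = iota x.
Proof.
move=> zq; have q1 := finNzRing_gt1 F.
have sP : size ('X^q - 'X : {poly E}) = q.+1.
  by rewrite size_polyDl ?size_polyXn // size_polyN size_polyX ltnS.
have P0 : 'X^q - 'X != 0 :> {poly E} by rewrite -size_poly_eq0 sP.
pose s := [seq iota x | x <- enum F].
have [/mapP[x _ ->]|zs] := boolP (z \in s); first by exists x.
have := @max_poly_roots _ _ (z :: s) P0.
rewrite sP /= zs map_inj_uniq ?enum_uniq; last exact: fmorph_inj.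
rewrite size_map -cardE ltnn => absurd; case: notF; apply: absurd => //.
rewrite rootE !hornerE zq subrr eqxx /=.
by apply/allP => _ /mapP[x _ ->]; rewrite rootE !hornerE -rmorphXn expf_card subrr.
Qed.

Let exprqD (x y : E) : (x + y) ^+ q = x ^+ q + y ^+ q.
Proof.
have [p pp pcharFp] := finPcharP F.
have pcharEp : p \in [pchar E] by rewrite (fmorph_pchar iota).
have [n cF] := finField_card_pow pcharFp.
by rewrite cF; exact: exprDn_pchar_pow.
Qed.

Let exprqq (z : E) : z ^+ q ^+ q = z.
Proof. by rewrite -exprM mulnn -card_ext expf_card. Qed.

Variables (psi : F -> algC) (psi' : E -> algC) (a b : F).
Hypothesis psiP : additive_char psi.
(** In other words, [psi'] is [psi] composed with the relative trace from [E] to [F]. *)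
Hypothesis psi'E : forall z s, iota s = z + z ^+ q -> psi' z = psi s.
Hypotheses (a0 : a != 0) (b0 : b != 0).

Let A (t : F * F) := #|[set x | x * (t.1 - x) == t.2]|.
Let B (t : F * F) :=
  #|[set z | (z + z ^+ q == iota t.1) && (z * z ^+ q == iota t.2)]|.

(* [A] and [B] count the roots of [X^2 - sX + n] in [F], and those in [E] whose
   conjugate is the other root. *)
Let AB_le2 t : (A t + B t <= 2)%N.
Proof.
case: t => s n; rewrite /A /B /=; set RA := [set x | _]; set RB := [set z | _].
have RBroot z : z \in RB -> z * (iota s - z) = iota n.
  by rewrite inE => /andP[/eqP <- /eqP <-]; ring.
have [RA0|[x xRA]] := set_0Vmem RA.
  rewrite RA0 cards0 add0n; have [->|[z zRB]] := set_0Vmem RB; first by rewrite cards0.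
  rewrite (leq_trans (subset_leq_card (_ : RB \subset [set z; iota s - z]))) //.
    apply/subsetP => w /RBroot; rewrite -(RBroot z zRB) => /eqP.
    rewrite -subr_eq0 (_ : _ - _ = (w - z) * (iota s - z - w)); last by ring.
    by rewrite mulf_eq0 !subr_eq0 !inE [_ == w]eq_sym.
  by rewrite cards2; case: eqP.
have xn : x * (s - x) = n by move: xRA; rewrite inE => /eqP.
have RAs : RA \subset [set x; s - x].
  apply/subsetP => w; rewrite inE -xn -subr_eq0.
  rewrite (_ : _ - _ = (w - x) * (s - x - w)); last by ring.
  by rewrite mulf_eq0 !subr_eq0 !inE [_ == w]eq_sym.
(* If the quadratic splits in [F], an element of [RB] is a root lying in [F], hence its own
   conjugate. The two roots then coincide, and [RA] and [RB] are singletons. *)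
have RBs z : z \in RB -> z = iota x /\ x = s - x.
  move=> zRB; have : (z == iota x) || (z == iota (s - x)).
    move: (RBroot z zRB) => /eqP; rewrite -xn -subr_eq0 rmorphM rmorphB.
    rewrite (_ : _ - _ = (z - iota x) * (iota s - iota x - z)); last by ring.
    by rewrite mulf_eq0 !subr_eq0 [_ == z]eq_sym.
  move: zRB; rewrite inE => /andP[/eqP tz _].
  case/orP => /eqP zE; move: tz; rewrite zE -rmorphXn expf_card -rmorphD.
    by move/fmorph_inj => <-; rewrite addrK.
  move/fmorph_inj => e; have xE : x = s - x.
    have dE : x - (s - x) = s - (s - x + (s - x)) by ring.
    by apply: subr0_eq; rewrite dE e subrr.
  by rewrite -xE.
have [RB0|[z zRB]] := set_0Vmem RB.
  rewrite RB0 cards0 addn0 (leq_trans (subset_leq_card RAs)) // cards2.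
  by case: eqP.
have [_ xE] := RBs z zRB.
rewrite (leq_trans (leq_add (subset_leq_card RAs) (subset_leq_card
  (_ : RB \subset [set iota x])))) // -?xE ?setUid ?cards1 //.
by apply/subsetP => w /RBs[-> _]; rewrite inE.
Qed.

Let traceE : exists t : E -> F, forall z, iota (t z) = z + z ^+ q.
Proof.
apply: (@fin_all_exists E (fun=> F) (fun z s => iota s = z + z ^+ q)) => z.
have [|s ->] := @expr_card_fixed (z + z ^+ q); last by exists s.
by rewrite exprqD exprqq addrC.
Qed.

Let normE : exists t : E -> F, forall z, iota (t z) = z * z ^+ q.
Proof.
apply: (@fin_all_exists E (fun=> F) (fun z s => iota s = z * z ^+ q)) => z.
have [|s ->] := @expr_card_fixed (z * z ^+ q); last by exists s.
by rewrite exprMn exprqq mulrC.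
Qed.

Let sumA (G : F * F -> algC) :
  \sum_x \sum_y G (x + y, x * y) = \sum_t (A t)%:R * G t.
Proof.
rewrite pair_bigA /= (partition_big (fun u => (u.1 + u.2, u.1 * u.2)) predT) //=.
apply: eq_bigr => [[s n] _] /=.
rewrite (eq_bigr (fun=> G (s, n))); last by move=> u /eqP ->.
rewrite sumr_const mulr_natl; congr (_ *+ _).
rewrite /A /=; rewrite -(card_imset _ (_ : injective (fun x => (x, s - x)))).
  apply: eq_card => [[x y]]; rewrite [LHS]unfold_in /=.
  apply/andP/imsetP => [[/eqP<- /eqP<-]|[w]].
    by exists x; rewrite ?inE; rewrite addrC addKr // mulrC.
  by rewrite inE => /eqP <- [-> ->]; rewrite addrC subrK !eqxx.
by move=> x y [].
Qed.

Let sumB (G : F * F -> algC) (t n : E -> F) :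
    (forall z, iota (t z) = z + z ^+ q) -> (forall z, iota (n z) = z * z ^+ q) ->
  \sum_z G (t z, n z) = \sum_t (B t)%:R * G t.
Proof.
move=> tE nE; rewrite (partition_big (fun z => (t z, n z)) predT) //=.
apply: eq_bigr => [[s m] _] /=.
rewrite (eq_bigr (fun=> G (s, m))); last by move=> u /eqP ->.
rewrite sumr_const mulr_natl; congr (_ *+ _).
rewrite /B; apply: eq_card => z; rewrite [LHS]unfold_in [RHS]inE /=.
by rewrite -tE -nE !(inj_eq (@fmorph_inj _ _ iota)).
Qed.

(* Both [A] and [B] sum to [q^2] over the [q^2] pairs [(s, n)], so the upper bound
   [2] is attained everywhere. *)
Let AB_eq2 t : (A t + B t = 2)%N.
Proof.
have [[tr trE] [n nE]] := (traceE, normE).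
have sA : \sum_t (A t)%:R = (q ^ 2)%:R :> algC.
  have := sumA (fun=> 1); under [in RHS]eq_bigr do rewrite mulr1.
  by move=> <-; rewrite pair_bigA sumr_const card_prod mulnn.
have sB : \sum_t (B t)%:R = (q ^ 2)%:R :> algC.
  have := sumB (fun=> 1) trE nE; under [in RHS]eq_bigr do rewrite mulr1.
  by move=> <-; rewrite sumr_const -card_ext.
have /eqP : (\sum_t (2 - (A t + B t)) = 0)%N.
  rewrite sumnB // big_split /= sum_nat_const card_prod.
  have -> : (\sum_t A t = q ^ 2)%N by apply/eqP; rewrite -(eqr_nat algC) natr_sum sA.
  have -> : (\sum_t B t = q ^ 2)%N by apply/eqP; rewrite -(eqr_nat algC) natr_sum sB.
  by rewrite mulnn muln2 addnn subnn.
rewrite sum_nat_eq0 => /forallP/(_ t); have := AB_le2 t; lia.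
Qed.

(** Both terms sum the same function [G]: the square over pairs of [F], through sum and product, the
    lifted sum over [E], through trace and norm. The weights [A] and [B] add up to [2] everywhere,
    which leaves twice the plain sum of [G]. *)
Lemma kloosterman_doubling :
  kloosterman psi a b ^+ 2 + kloosterman psi' (iota a) (iota b) = 2 * q%:R.
Proof.
have [psi0 psiD _] := psiP; have [[tr trE] [n nE]] := (traceE, normE).
pose G (t : F * F) := (t.2 != 0)%:R * psi (a * t.1 + b * t.1 / t.2).
have K1 : kloosterman psi a b ^+ 2 = \sum_x \sum_y G (x + y, x * y).
  rewrite expr2 /kloosterman big_distrlr /= [LHS]big_mkcond /=.
  apply: eq_bigr => x _; have [->|x0] /= := eqVneq x 0.
    by rewrite big1 // => y _; rewrite /G /= mul0r eqxx mul0r.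
  rewrite [LHS]big_mkcond; apply: eq_bigr => y _; rewrite /G /= mulf_eq0 (negPf x0).
  have [->|y0] /= := eqVneq y 0; first by rewrite mul0r.
  by rewrite mul1r -psiD; congr psi; field; rewrite x0 y0.
have K2 : kloosterman psi' (iota a) (iota b) = \sum_z G (tr z, n z).
  rewrite /kloosterman [LHS]big_mkcond; apply: eq_bigr => z _.
  have n0 : (n z == 0) = (z == 0).
    by rewrite -(fmorph_eq0 iota) nE mulf_eq0 expf_eq0 (ltnW (finNzRing_gt1 F)) orbb.
  rewrite /G /= n0; have [_|z0] /= := eqVneq z 0; first by rewrite mul0r.
  rewrite mul1r; apply: psi'E.
  rewrite rmorphD !rmorphM fmorphV /= trE nE exprqD !exprMn exprVn -!rmorphXn.
  by rewrite !expf_card; field; rewrite expf_neq0 ?z0.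
rewrite K1 K2 sumA (sumB _ trE nE) -big_split /=.
transitivity (\sum_t 2 * G t).
  by apply: eq_bigr => t _; rewrite -mulrDl -natrD AB_eq2.
rewrite -mulr_sumr; congr (_ * _).
rewrite -(pair_bigA _ (fun s m => G (s, m))) exchange_big /=.
(* Summing over the first coordinate [s] kills every [m] except the one where the coefficient
   [a + b / m] of [s] vanishes; that one contributes [q]. *)
have m0 : - b / a != 0 by rewrite mulf_neq0 ?oppr_eq0 ?invr_eq0.
rewrite (bigD1 (- b / a)) //= [X in _ + X]big1 ?addr0; last first.
  move=> m nm; rewrite /G /=; have [->|mn0] /= := eqVneq m 0.
    by rewrite big1 // => s _; rewrite mul0r.
  have : a + b / m != 0.
    apply: contraNneq nm => e; apply/eqP; apply: (mulIf a0); rewrite divfK //.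
    have dE : m * a - - b = m * (a + b / m) by field.
    by apply: subr0_eq; rewrite dE e mulr0.
  move/negPf => h; have := sum_additive_char psiP (a + b / m).
  rewrite h mulr0; apply: etrans; apply: eq_bigr => s _.
  by rewrite mul1r; congr psi; field.
rewrite /G /= m0; have := sum_additive_char psiP 0.
rewrite eqxx mulr1 => <-; apply: eq_bigr => s _; rewrite mul1r; congr psi.
by field; rewrite a0 oppr_eq0 b0.
Qed.

End Doubling.

(** * The Weil bound for Kloosterman sums *)

(** The map [x^2 - x] identifies [0] and [1], so on a finite field it misses some [c], and
    [X^2 - X - c] is irreducible. This choice works in characteristic [2] as well. *)
Lemma quadratic_extension (F : finFieldType) :
  exists (E : finFieldType) (iota : {rmorphism F -> E}), #|E| = (#|F| ^ 2)%N.
Proof.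
have [c /forallP cN] : exists c : F, [forall x : F, x ^+ 2 - x != c].
  apply/existsP; apply: contraT; rewrite negb_exists => /forallP H.
  have surj c : exists x : F, x ^+ 2 - x == c.
    by have := H c; rewrite negb_forall => /existsP[x]; rewrite negbK; exists x.
  have gK : cancel (fun c => xchoose (surj c)) (fun x => x ^+ 2 - x).
    by move=> c; apply/eqP; exact: (xchooseP (surj c)).
  have /eqP : 1 = 0 :> F.
    by apply: (can_inj (canF_sym gK)); rewrite expr0n expr1n !subrr.
  by rewrite oner_eq0.
pose h : {poly F} := 'X^2 - ('X + c%:P).
have sX : (size ('X + c%:P)%R <= 2)%N.
  by rewrite (leq_trans (size_polyD _ _)) // geq_max size_polyX size_polyC; case: eqP.
have sh : size h = 3 by rewrite size_polyDl size_polyXn // size_polyN.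
have mh : h \is monic.
  by rewrite monicE lead_coefDl ?lead_coefXn // size_polyN size_polyXn.
have ih : irreducible_poly h.
  apply: cubic_irreducible; first by rewrite sh.
  move=> x; rewrite rootE !hornerE opprD addrA subr_eq0; exact: cN.
pose hI : monic_irreducible_poly h := (ih, mh).
pose E : finFieldType := {poly %/ h with hI}.
pose iota : {rmorphism F -> E} := qpolyC h.
by exists E, iota; rewrite card_qfpoly sh.
Qed.

Section WeilBound.

Variables (p : nat) (zeta : algC).
Hypothesis zeta_prim : p.-primitive_root zeta.

(** Transitivity of the trace: the exponents [i] and [r + i] pair up to [(z + z^q)^(p^i)], where [q]
    is [#|F|]. *)
Lemma addchar_ext (F E : finFieldType) (iota : {rmorphism F -> E}) r z s :
    p \in [pchar F] -> #|F| = (p ^ r)%N -> iota s = z + z ^+ #|F| ->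
    #|E| = (#|F| ^ 2)%N ->
  addchar zeta p (r * 2) z = addchar zeta p r s.
Proof.
move=> pcharFp cF sE cE.
have pcharEp : p \in [pchar E] by rewrite (fmorph_pchar iota).
have [k _ ks] := ftrace_nat pcharFp cF s.
rewrite (addchar_nat pcharFp cF zeta_prim ks).
apply: (addchar_nat pcharEp) => //; first by rewrite cE cF expnM.
rewrite -(rmorph_nat iota) -ks /ftrace rmorph_sum muln2 -addnn big_split_ord /=.
rewrite -big_split; apply: eq_bigr => i _ /=.
rewrite rmorphXn sE (exprDn_pchar_pow pcharEp) cF -exprM -expnD.
by congr (_ + _ ^+ (p ^ _)).
Qed.

Lemma kloosterman_tower k (F : finFieldType) r (a b : F) :
    p \in [pchar F] -> #|F| = (p ^ r)%N -> a != 0 -> b != 0 ->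
    4 < kloosterman (addchar zeta p r) a b ^+ 2 / #|F|%:R ->
  exists (E : finFieldType) (a' b' : E),
    [/\ p \in [pchar E], #|E| = (p ^ (r * 2 ^ k))%N, a' != 0 &
     4 ^+ k * (kloosterman (addchar zeta p r) a b ^+ 2 / #|F|%:R - 4)
       <= kloosterman (addchar zeta p (r * 2 ^ k)) a' b' ^+ 2 / #|E|%:R - 4].
Proof.
elim: k F r a b => [|k IH] F r a b pcharFp cF a0 b0 K4.
  by exists F, a, b; rewrite expn0 muln1 expr0 mul1r.
have [E [iota cE]] := quadratic_extension F.
have pcharEp : p \in [pchar E] by rewrite (fmorph_pchar iota).
have psiP := addchar_additive pcharFp cF zeta_prim.
have dbl := kloosterman_doubling (iota := iota) cE psiP
  (fun z s e => addchar_ext pcharFp cF e cE) a0 b0.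
set K := kloosterman _ a b in K4 dbl *.
pose K1 := kloosterman (addchar zeta p (r * 2)) (iota a) (iota b).
rewrite -/K1 in dbl.
have q0 : #|F|%:R != 0 :> algC by rewrite pnatr_eq0 -lt0n (ltnW (finNzRing_gt1 F)).
pose t := K ^+ 2 / #|F|%:R.
(* The doubling identity sends [t] to [(t - 2)^2], and [(t - 2)^2 - 4 = t (t - 4)] with [t > 4]. *)
have K1E : K1 ^+ 2 / #|E|%:R - 4 = t * (t - 4).
  have -> : K1 = 2 * #|F|%:R - K ^+ 2 by rewrite -dbl addrC addKr.
  by rewrite /t cE natrX; field.
have t4 : 0 < t - 4 by rewrite subr_gt0.
have le4 : 4 * (t - 4) <= K1 ^+ 2 / #|E|%:R - 4.
  by rewrite K1E ler_pM2r // ltW.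
have [||||E' [a' [b' [pE' cE' a'0 le]]]] := IH E (r * 2)%N (iota a) (iota b) pcharEp.
- by rewrite cE cF expnM.
- by rewrite fmorph_eq0.
- by rewrite fmorph_eq0.
- by rewrite -subr_gt0 (lt_le_trans _ le4) // mulr_gt0.
rewrite -mulnA -expnS in cE' le.
exists E', a', b'; split => //; apply: le_trans le.
by rewrite exprSr -mulrA ler_pM2l ?exprn_gt0.
Qed.

Lemma kloosterman_bound (F : finFieldType) r (a b : F) :
    p \in [pchar F] -> #|F| = (p ^ r)%N -> a != 0 ->
  kloosterman (addchar zeta p r) a b ^+ 2 <= 4 * #|F|%:R.
Proof.
move=> pcharFp cF a0; have psiP := addchar_additive pcharFp cF zeta_prim.
have q1 := finNzRing_gt1 F.
(* For [b = 0] the sum is [-1] by orthogonality; doubling requires [b != 0]. *)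
have [->|b0] := eqVneq b 0.
  have -> : kloosterman (addchar zeta p r) a 0 = -1.
    have := sum_additive_char psiP a; rewrite (negPf a0) mulr0 (bigD1 0) //=.
    rewrite mulr0; case: (psiP) => -> _ _ /eqP; rewrite addrC addr_eq0 => /eqP <-.
    by apply: eq_bigr => x _; rewrite mul0r addr0.
  by rewrite sqrrN expr1n -natrM ler1n muln_gt0 (ltnW q1).
have q0 : 0 < #|F|%:R :> algC by rewrite ltr0n ltnW.
rewrite -ler_pdivrMr //; set t := _ / _.
have tR : t \is Num.real.
  by rewrite rpredM ?rpredX ?rpredV ?realn ?(kloosterman_real psiP).
rewrite real_leNgt ?realn //; apply/negP => t4.
pose d := t - 4; have d0 : 0 < d by rewrite subr_gt0.
(* After [k + 1] doublings the excess passes the ceiling [9 p^2]. Positivity of [k] makes half of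
   the resulting exponent exceed [1], as the weak bound demands. *)
have [k k0 kd] : exists2 k, (0 < k)%N & (9 * p ^ 2)%:R / d < 4 ^+ k.+1.
  have x0 : 0 <= (9 * p ^ 2)%:R / d by rewrite divr_ge0 ?ler0n // ltW.
  have := archi_boundP x0; set l := Num.bound _ => ltl; exists l.+1 => //.
  apply: lt_trans ltl _; rewrite -natrX ltr_nat (leq_trans (ltn_expl l (isT : 1 < 4)%N)) //.
  by rewrite leq_exp2l // -addn2 leq_addr.
have [E [a' [b' [pE cE a'0 le]]]] := kloosterman_tower k.+1 pcharFp cF a0 b0 t4.
have r0 : (0 < r)%N by case: (r) cF q1 => // ->.
have pp := pcharf_prime pE; have p1 := prime_gt1 pp.
have [m m1 mE] : exists2 m, (1 < m)%N & (r * 2 ^ k.+1 = 2 * m)%N.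
  exists (r * 2 ^ k)%N; last by rewrite expnS mulnCA.
  by rewrite (leq_trans (_ : 1 < 2 ^ k)%N) ?leq_pmull // -{1}(expn0 2) ltn_exp2l.
rewrite mE in cE le.
have wk := kloosterman_weak b' pE cE m1 zeta_prim a'0.
have psiE := addchar_additive pE cE zeta_prim.
(* The ceiling comes from [2 p^(m+1) + 1 <= 3 p^(m+1)], squared and divided by [#|E| = p^(2m)]. *)
have : 4 ^+ k.+1 * d < (9 * p ^ 2)%:R.
  apply: le_lt_trans le _; rewrite ltrBlDr.
  apply: (@le_lt_trans _ _ (9 * p ^ 2)%:R); last by rewrite ltrDl.
  rewrite ler_pdivrMr ?ltr0n ?cE ?expn_gt0 ?(ltnW p1) //.
  rewrite -real_normK ?(kloosterman_real psiE) //.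
  apply: (@le_trans _ _ ((3 * p ^ m.+1)%:R ^+ 2)).
    rewrite ler_pXn2r ?nnegrE ?ler0n // (le_trans wk) // ler_nat.
    by rewrite [(3 * _)%N]mulSn -add1n leq_add2r expn_gt0 ltnW.
  rewrite -natrX -natrM ler_nat.
  by rewrite (_ : 9 = 3 ^ 2)%N // (expnS p m) !expnMn mulnA -expnM (mulnC m).
by rewrite -ltr_pdivlMr // => /(lt_trans kd); rewrite ltxx.
Qed.

End WeilBound.

(** * Fourier analysis on two-by-two matrices *)

(** By Lagrange's identity, twice the defect is a sum of squares. *)
Lemma sum_Cauchy_Schwarz (R : numDomainType) (I : finType) (x y : I -> R) :
    (forall i, x i \is Num.real) -> (forall i, y i \is Num.real) ->
  (\sum_i x i * y i) ^+ 2 <= (\sum_i x i ^+ 2) * (\sum_i y i ^+ 2).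
Proof.
move=> xR yR; rewrite -subr_ge0.
have : 0 <= \sum_i \sum_j (x i * y j - x j * y i) ^+ 2.
  by do 2![apply: sumr_ge0 => ? _]; rewrite real_exprn_even_ge0 // rpredB ?rpredM.
have -> : \sum_i \sum_j (x i * y j - x j * y i) ^+ 2 =
    ((\sum_i x i ^+ 2) * (\sum_i y i ^+ 2) - (\sum_i x i * y i) ^+ 2) *+ 2.
  have -> (X Y Z : R) : (X * Y - Z ^+ 2) *+ 2 = X * Y + Y * X - 2 * (Z * Z) by ring.
  rewrite !big_distrlr /= mulr_sumr -big_split -sumrB /=; apply: eq_bigr => i _.
  by rewrite mulr_sumr -big_split -sumrB /=; apply: eq_bigr => j _; ring.
by rewrite pmulrn_lge0.
Qed.

Section MatrixFourier.

Variables (F : finFieldType) (psi : F -> algC).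
Hypothesis psiP : additive_char psi.
Local Notation q := (#|F|%:R : algC).
Local Notation mx2 := 'M[F]_2.

Let psi0 : psi 0 = 1. Proof. by case: psiP. Qed.
Let psiD x y : psi (x + y) = psi x * psi y. Proof. by case: psiP. Qed.
Let q_neq0 : q != 0.
Proof. by rewrite pnatr_eq0 -lt0n (ltnW (finNzRing_gt1 F)). Qed.

Definition mk_mx2 (a b c d : F) : mx2 :=
  \matrix_(i, j) if i == 0 then if j == 0 then a else b
                 else if j == 0 then c else d.

Lemma sum_mx2 (G : mx2 -> algC) :
  \sum_M G M = \sum_a \sum_b \sum_c \sum_d G (mk_mx2 a b c d).
Proof.
do 3![rewrite pair_bigA /=].
rewrite (reindex (fun u : F * F * F * F => mk_mx2 u.1.1.1 u.1.1.2 u.1.2 u.2)) //=.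
exists (fun M => (M 0 0, M 0 1, M 1 0, M 1 1)) => [[[[a b] c] d]|M] _ /=.
  by rewrite !mxE.
apply/matrixP => i j; rewrite mxE.
by case: i => [[|[|//]] ?]; case: j => [[|[|//]] ?] /=; congr (M _ _); apply: val_inj.
Qed.

Lemma det_mx2 (M : mx2) : \det M = M 0 0 * M 1 1 - M 0 1 * M 1 0.
Proof.
rewrite (expand_det_row M 0) !big_ord_recl big_ord0 /cofactor !det_mx11 !mxE /=.
have -> : lift 0 0 = 1 :> 'I_2 by apply: val_inj.
have -> : lift 1 0 = 0 :> 'I_2 by apply: val_inj.
by rewrite addr0 expr0 expr1; ring.
Qed.

Lemma mxtrace_mul_mx2 (M N : mx2) :
  \tr (M *m N) = M 0 0 * N 0 0 + M 0 1 * N 1 0 + (M 1 0 * N 0 1 + M 1 1 * N 1 1).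
Proof.
rewrite /mxtrace !big_ord_recl big_ord0 !mxE !big_ord_recl !big_ord0 /= !addr0.
by have -> : lift 0 0 = 1 :> 'I_2 by apply: val_inj.
Qed.

(** The additive characters of the matrix space, indexed through the trace pairing. *)
Let ev (m x : mx2) := psi (\tr (m *m x)).

Let evD m x y : ev m (x + y) = ev m x * ev m y.
Proof. by rewrite /ev mulmxDr raddfD psiD. Qed.

Let evN m x : ev m (- x) = (ev m x)^*.
Proof. by rewrite /ev mulmxN raddfN; exact: additive_charN. Qed.

Lemma mk_mx2E (M : mx2) : M = mk_mx2 (M 0 0) (M 0 1) (M 1 0) (M 1 1).
Proof.
apply/matrixP => i j; rewrite mxE.
by case: i => [[|[|//]] ?]; case: j => [[|[|//]] ?] /=; congr (M _ _); apply: val_inj.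
Qed.

Let sum_ev x : \sum_m ev m x = q ^+ 4 * (x == 0)%:R.
Proof.
rewrite sum_mx2 [x]mk_mx2E; set x1 := x 0 0; set x2 := x 0 1.
set x3 := x 1 0; set x4 := x 1 1.
have -> : (mk_mx2 x1 x2 x3 x4 == 0)%:R
    = (x1 == 0)%:R * (x3 == 0)%:R * ((x2 == 0)%:R * (x4 == 0)%:R) :> algC.
  rewrite -!natrM !mulnb; congr (nat_of_bool _)%:R.
  apply/eqP/andP => [e|[/andP[/eqP-> /eqP->] /andP[/eqP-> /eqP->]]].
    have E i j : mk_mx2 x1 x2 x3 x4 i j = 0 by rewrite e mxE.
    move: (E 0 0) (E 0 1) (E 1 0) (E 1 1); rewrite !mxE /= => -> -> -> ->.
    by rewrite eqxx.
  by apply/matrixP => i j; rewrite !mxE; do 2!case: ifP.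
have S y : \sum_a psi (a * y) = q * (y == 0)%:R.
  by rewrite -(sum_additive_char psiP); apply: eq_bigr => a _; rewrite mulrC.
transitivity ((\sum_a psi (a * x1)) * (\sum_b psi (b * x3)) *
              ((\sum_c psi (c * x2)) * (\sum_d psi (d * x4)))).
  rewrite mulr_suml mulr_suml; apply: eq_bigr => a _.
  rewrite mulr_sumr mulr_suml; apply: eq_bigr => b _.
  rewrite mulr_suml mulr_sumr; apply: eq_bigr => c _.
  rewrite !mulr_sumr; apply: eq_bigr => d _.
  by rewrite /ev mxtrace_mul_mx2 !mxE /= !psiD.
by rewrite !S; ring.
Qed.

(** The determinant is a split form: the diagonal and antidiagonal products separate, and each
    contributes a factor [q]. *)
Let sum_psi_det (s : F) : s != 0 -> \sum_(x : mx2) psi (s * \det x) = q ^+ 2.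
Proof.
move=> s0; rewrite sum_mx2.
have S t : t != 0 -> \sum_x \sum_y psi (t * (x * y)) = q.
  move=> t0; rewrite (bigD1 0) //= [X in _ + X]big1 ?addr0.
    under eq_bigr do rewrite mul0r mulr0 psi0.
    by rewrite sumr_const.
  move=> x x0; have := sum_additive_char psiP (t * x).
  rewrite mulf_eq0 (negPf t0) (negPf x0) mulr0; apply: etrans.
  by apply: eq_bigr => y _; rewrite mulrA.
rewrite expr2 -{1}(S s s0) -(S (- s)) ?oppr_eq0 // mulr_suml; apply: eq_bigr => a _.
rewrite mulr_sumr; under [RHS]eq_bigr do rewrite mulr_sumr.
apply: eq_bigr => b _; apply: eq_bigr => c _.
rewrite mulr_suml; apply: eq_bigr => d _.
by rewrite det_mx2 !mxE /= -psiD; congr psi; ring.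
Qed.

Let adj2 (m : mx2) := mk_mx2 (m 1 1) (- m 0 1) (- m 1 0) (m 0 0).

(** Polarizing [\det] against the adjugate [adj2 m] gives [\tr (m *m x)], so this shift removes the
    linear term. *)
Let complete_square (s : F) (m x : mx2) : s != 0 ->
  s * \det (x - s^-1 *: adj2 m) + \tr (m *m (x - s^-1 *: adj2 m))
    = s * \det x - \det m / s.
Proof. by move=> s0; rewrite !det_mx2 mxtrace_mul_mx2 !mxE /=; field. Qed.

(** The condition [\det x = 1] is detected by averaging [psi (s * (\det x - 1))] over [s]. The term
    [s = 0] gives the delta at [m = 0]; for [s != 0], completing the square gives
    [q^2 psi (- s - \det m / s)]. *)
Lemma sum_SL2_char m :
  \sum_(x : mx2 | \det x == 1) ev m x
    = q ^+ 3 * (m == 0)%:R + q * kloosterman psi (-1) (- \det m).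
Proof.
apply: (mulfI q_neq0); rewrite mulr_sumr.
transitivity (\sum_x \sum_s psi (s * (\det x - 1)) * ev m x).
  rewrite big_mkcond; apply: eq_bigr => x _; rewrite -mulr_suml.
  under eq_bigr do rewrite mulrC.
  rewrite (sum_additive_char psiP) subr_eq0.
  by case: eqP => _; rewrite ?mulr1 // mulr0 mul0r.
rewrite exchange_big (bigD1 0) //= mulrDr; congr (_ + _).
  under eq_bigr do rewrite mul0r psi0 mul1r /ev mxtrace_mulC.
  by have := sum_ev m; rewrite /ev => ->; ring.
rewrite mulrA -expr2 /kloosterman mulr_sumr; apply: eq_bigr => s s0.
rewrite -(sum_psi_det s0) mulr_suml.
rewrite (reindex (fun x => x - s^-1 *: adj2 m)) /=; last first.
  by exists (fun x => x + s^-1 *: adj2 m) => x _; rewrite ?subrK ?addrK.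
apply: eq_bigr => x _; rewrite /ev -!psiD; congr psi.
have := complete_square m x s0; set d := \det _; set t := \tr _ => e.
have -> : s * (d - 1) + t = s * d + t - s by ring.
by rewrite e; field.
Qed.

Let hat (B : {set mx2}) m := \sum_(b in B) ev m b.

Let hat_Parseval B : \sum_m `|hat B m| ^+ 2 = q ^+ 4 * #|B|%:R.
Proof.
transitivity (\sum_m \sum_(b in B) \sum_(b' in B) ev m (b - b')).
  apply: eq_bigr => m _; rewrite normCK rmorph_sum big_distrlr /=.
  by apply: eq_bigr => b _; apply: eq_bigr => b' _; rewrite evD evN.
rewrite exchange_big -[X in _ * X]sumr_const mulr_sumr /=; apply: eq_bigr => b bB.
rewrite exchange_big (bigD1 b) //= sum_ev subrr eqxx mulr1 big1 ?addr0 ?mulr1 //.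
by move=> b' /andP[_ nb]; rewrite sum_ev subr_eq0 eq_sym (negPf nb) mulr0.
Qed.

(** Characters diagonalize the Cayley graph: summing over [m] first forces [x = c - b]. *)
Let edge_hat (B C : {set mx2}) :
  q ^+ 4 * (\sum_(b in B) \sum_(c in C) ((c - b)%R \in SL2 F))%:R =
  \sum_m (\sum_(x : mx2 | \det x == 1) ev m x) * (hat B m * (hat C m)^*).
Proof.
transitivity (\sum_m \sum_(b in B) \sum_(c in C) \sum_(x : mx2 | \det x == 1)
    ev m (x + (b - c))); last first.
  apply: eq_bigr => m _; rewrite rmorph_sum big_distrlr mulr_sumr /=.
  apply: eq_bigr => b _; rewrite mulr_sumr; apply: eq_bigr => c _.
  by rewrite mulr_suml; apply: eq_bigr => x _; rewrite !evD evN.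
rewrite natr_sum mulr_sumr [RHS]exchange_big /=; apply: eq_bigr => b _.
rewrite natr_sum mulr_sumr [RHS]exchange_big /=; apply: eq_bigr => c _.
rewrite exchange_big /=; under eq_bigr do rewrite sum_ev.
rewrite -mulr_sumr; congr (_ * _); rewrite inE big_mkcond (bigD1 (c - b)) //=.
rewrite big1 ?addr0 => [|x /negPf nx].
  by rewrite -(opprB c b) subrr eqxx; case: eqP.
by rewrite -(opprB c b) subr_eq0 nx if_same.
Qed.

(** The expander mixing lemma, squared to avoid roots. The delta at [m = 0] supplies the main term;
    Cauchy-Schwarz and Parseval bound the remainder [X], which keeps the Kloosterman part at
    [m = 0]. *)
Lemma SL2_edge_count (B C : {set mx2}) :
    (forall b, kloosterman psi (-1) b ^+ 2 <= 4 * q) ->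
  (q * (\sum_(b in B) \sum_(c in C) ((c - b)%R \in SL2 F))%:R
     - #|B|%:R * #|C|%:R) ^+ 2 <= 4 * q ^+ 5 * (#|B|%:R * #|C|%:R).
Proof.
move=> Kle; set I := (\sum_(b in B) _)%N; set bc : algC := #|B|%:R * #|C|%:R.
pose K (m : mx2) := kloosterman psi (-1) (- \det m).
have q_gt0 : 0 < q by rewrite lt0r q_neq0 ler0n.
have hat0 (D : {set mx2}) : hat D 0 = #|D|%:R.
  rewrite -sumr_const; apply: eq_bigr => d _.
  by rewrite /ev mul0mx raddf0 psi0.
pose X := \sum_m K m * (hat B m * (hat C m)^*).
have XE : X = q ^+ 2 * (q * I%:R - bc).
  apply: (mulfI q_neq0); rewrite mulrA -exprS mulrBr mulrA -exprSr edge_hat.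
  under eq_bigr do rewrite sum_SL2_char mulrDl -mulrA -[q * _ * _]mulrA.
  rewrite big_split /= -!mulr_sumr -/X (bigD1 0) //= eqxx mul1r !hat0 conjC_nat.
  rewrite big1 ?addr0 => [|m /negPf ->]; last by rewrite mul0r.
  by rewrite -/bc addrAC subrr add0r.
have XR : X \is Num.real.
  by rewrite XE rpredM ?rpredX ?rpredB ?rpredM ?realn.
have : X ^+ 2 <= 4 * q * (q ^+ 4 * #|B|%:R) * (q ^+ 4 * #|C|%:R).
  rewrite -(real_normK XR).
  apply: (@le_trans _ _ ((\sum_m `|K m * hat B m| * `|hat C m|) ^+ 2)).
    rewrite ler_pXn2r ?nnegrE ?normr_ge0 ?sumr_ge0 // => [|m _]; last by rewrite mulr_ge0.
    apply: le_trans (ler_norm_sum _ _ _) _; apply: ler_sum => m _.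
    by rewrite mulrA normrM norm_conjC.
  apply: le_trans (sum_Cauchy_Schwarz _ _) _; try by move=> m; exact: normr_real.
  rewrite !hat_Parseval ler_wpM2r ?mulr_ge0 ?exprn_ge0 ?ler0n //.
  rewrite -hat_Parseval mulr_sumr; apply: ler_sum => m _.
  rewrite normrM exprMn ler_wpM2r ?exprn_ge0 //.
  by rewrite real_normK; [exact: Kle | exact: kloosterman_real].
have -> : 4 * q * (q ^+ 4 * #|B|%:R) * (q ^+ 4 * #|C|%:R)
    = q ^+ 4 * (4 * q ^+ 5 * bc) by rewrite /bc; ring.
by rewrite XE exprMn -exprM ler_pM2l // exprn_gt0.
Qed.

End MatrixFourier.

(** * From edge counts to the sumset bound *)

Lemma SL2_sumset_edges (F : finFieldType) (A B : {set 'M[F]_2}) : A \subset SL2 F ->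
  (#|A| * #|B| <=
     \sum_(b in B) \sum_(c in sumset A B) ((c - b)%R \in SL2 F))%N.
Proof.
move=> AS; rewrite mulnC -sum_nat_const; apply: leq_sum => b bB.
rewrite -(card_imset A (addIr b)) -sum1_card.
rewrite [leqRHS](bigID (mem [set x + b | x in A])) /=.
rewrite (leq_trans _ (leq_addr _ _)) // big_mkcond [leqRHS]big_mkcond /=.
apply: leq_sum => c _; case: ifP => // /imsetP[a aA ->].
by rewrite addrK (subsetP AS) // andbT; case: ifP => // /negP[]; apply/imset2P; exists a b.
Qed.

(** The main term [|B||C|/q] of the edge count is compared with [|A||B|/2]. When it is smaller, the
    error term must account for at least half of the [|A||B|] edges. *)
Lemma SL2_sumset_card (F : finFieldType) (A B : {set 'M[F]_2}) : A \subset SL2 F ->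
  (#|A| * #|F| <= 2 * #|sumset A B|)%N \/
  (#|A| ^ 2 * #|B| <= 16 * #|F| ^ 3 * #|sumset A B|)%N.
Proof.
move=> AS; have [p pp pcharFp] := finPcharP F.
have [r cF] := finField_card_pow pcharFp.
have [zeta zp] := C_prim_root_exists (prime_gt0 pp).
have psiP := addchar_additive pcharFp cF zp.
have N1 : (-1 : F) != 0 by rewrite oppr_eq0 oner_eq0.
have := SL2_edge_count psiP B (sumset A B)
  (fun b => kloosterman_bound zp b pcharFp cF N1).
have := SL2_sumset_edges B AS; have q1 := ltnW (finNzRing_gt1 F).
move: (\sum_(b in B) _)%N q1 => I; move: #|A| #|B| #|sumset A B| #|F| => a b c q.
move=> q0 abI le; have [|ca] := leqP (a * q) (2 * c); [by left | right].
have [->|b0] := posnP b; first by rewrite muln0.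
(* This makes the truncated subtraction [q * I - b * c] exact. *)
have bcI : (b * c <= q * I)%N by nia.
move: le; rewrite -!natrM -natrB // -!natrX -!natrM ler_nat => le.
(* Squaring this factor [2] against the [4] of the edge count produces the constant [16]. *)
have h : (q * a * b <= 2 * (q * I - b * c))%N by nia.
have : ((q * a * b) ^ 2 <= 16 * q ^ 5 * (b * c))%N.
  rewrite (leq_trans (_ : _ <= (2 * (q * I - b * c)) ^ 2)%N) ?leq_exp2r //.
  by rewrite expnMn; lia.
have -> : ((q * a * b) ^ 2 = q ^ 2 * b * (a ^ 2 * b))%N by rewrite !expnMn; lia.
have -> : (16 * q ^ 5 * (b * c) = q ^ 2 * b * (16 * q ^ 3 * c))%N.
  by rewrite (expnD q 2 3); lia.
by rewrite leq_pmul2l // muln_gt0 expn_gt0 q0.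
Qed.

Theorem theorem1p3 (R : realType) :
  exists c : R, 0 < c /\
    forall (q : nat) (F : finFieldType) (A B : {set 'M[F]_2}),
      #|F| = q ->
      A \subset SL2 F ->
      c * Num.min (#|A|%:R ^+ 2 * #|B|%:R / q%:R ^+ 3) (#|A|%:R * q%:R)
        <= #|sumset A B|%:R.
Proof.
(* The second alternative dictates [16]; the first would allow [1/2]. *)
exists 16^-1; split=> [|q F A B <- AS]; first by rewrite invr_gt0 ltr0n.
rewrite mulrC ler_pdivrMr ?ltr0n // -!natrX -!natrM.
have [le|le] := SL2_sumset_card B AS.
  rewrite ge_min; apply/orP; right; rewrite ler_nat (leq_trans le) //.
  by rewrite mulnC leq_mul2l orbT.
rewrite ge_min; apply/orP; left.
rewrite ler_pdivrMr ?ltr0n ?expn_gt0 ?(ltnW (finNzRing_gt1 F)) //.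
by rewrite -natrM ler_nat (leq_trans le) //; lia.
Qed.
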